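(* Let $k$ be a field, let $n$ be a positive integer, let $R = k[x_1,\ldots,x_n]$, and let $X$ be a $3 \times 3$ matrix whose entries are linear forms in $R$. If the determinant $\det(X)$ vanishes (as an element of $R$), then $X$ is $f$-equivalent to at least one of the following: (1) a matrix with a zero row; (2) a matrix with a zero column; (3) a matrix with a zero square; (4) an antisymmetric matrix.
   Context: A linear form in $R$ is a homogeneous polynomial of degree $1$ with coefficients in $k$, the zero polynomial being allowed. Two $3\times 3$ matrices $X, Y$ with entries in $R$ are $f$-equivalent if there are invertible $3 \times 3$ matrices $F$ and $G$, both with entries in the field $k$, such that $Y = FXG$. A $3\times 3$ matrix has a zero square if it has a $2\times 2$ submatrix (obtained by choosing two rows and two columns) all of whose entries are zero; for example, a matrix of the form $\begin{pmatrix} \star & \star & \star \\ \star & 0 & 0 \\ \star & 0 & 0 \end{pmatrix}$. An antisymmetric matrix of linear forms is a matrix of the form $\begin{pmatrix} 0 & \varphi & -\chi \\ -\varphi & 0 & \psi \\ \chi & -\psi & 0 \end{pmatrix}$ with $\varphi,\chi,\psi$ linear forms in $R$ (in particular, the diagonal entries are zero). *)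

(* Defs.v *)
From HB Require Import structures.
From mathcomp Require Import all_boot all_order all_algebra.
From mathcomp Require Import mpoly.

Set Implicit Arguments.
Unset Strict Implicit.
Unset Printing Implicit Defensive.

Import GRing.Theory.
Local Open Scope ring_scope.

(* The zero polynomial is 1.-homog, hence a linear form. *)
Definition linear_form (k : fieldType) (n : nat) (p : {mpoly k[n]}) : Prop :=
  p \is 1.-homog.

Definition f_equivalent (k : fieldType) (n : nat)
    (X Y : 'M[{mpoly k[n]}]_3) : Prop :=
  exists F G : 'M[k]_3,
    [/\ F \in unitmx, G \in unitmx &
        Y = map_mx (@mpolyC n k) F *m X *m map_mx (@mpolyC n k) G].

Definition has_zero_row (R : nzRingType) (Y : 'M[R]_3) : Prop :=
  exists i : 'I_3, forall j : 'I_3, Y i j = 0.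

Definition has_zero_column (R : nzRingType) (Y : 'M[R]_3) : Prop :=
  exists j : 'I_3, forall i : 'I_3, Y i j = 0.

Definition has_zero_square (R : nzRingType) (Y : 'M[R]_3) : Prop :=
  exists i1 i2 j1 j2 : 'I_3,
    [/\ i1 != i2, j1 != j2 &
        [/\ Y i1 j1 = 0, Y i1 j2 = 0, Y i2 j1 = 0 & Y i2 j2 = 0]].

(* The diagonal is zero by definition, also in characteristic 2. *)
Definition antisym_mx (R : nzRingType) (phi chi psi : R) : 'M[R]_3 :=
  \matrix_(i < 3, j < 3)
    nth 0 (nth [::] [:: [::    0;  phi; - chi];
                        [:: - phi;   0;   psi];
                        [::   chi; - psi;   0]] i) j.

Definition is_antisymmetric (k : fieldType) (n : nat)
    (Y : 'M[{mpoly k[n]}]_3) : Prop :=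
  exists phi chi psi : {mpoly k[n]},
    [/\ linear_form phi, linear_form chi, linear_form psi &
        Y = antisym_mx phi chi psi].

(* Main.v *)
Require Import Defs.
From HB Require Import structures.
From mathcomp Require Import all_boot all_order all_algebra.
From mathcomp Require Import mpoly.
From mathcomp Require Import ring.

Set Implicit Arguments.
Unset Strict Implicit.
Unset Printing Implicit Defensive.

Import GRing.Theory.
Local Open Scope ring_scope.

(** The idea is that a singular 3 x 3 matrix X of linear forms should be
    killed, on the right or on the left, by a nonzero vector v whose entries are
    again linear forms; the four cases of the theorem are then the possible
    shapes of the linear syzygies among the entries of v.

    _From a linear kernel vector to the normal form_ (classify_right_kernel).
    A change of basis over k makes the nonzero entries of v linearly
    independent forms.  If there is one of them, the corresponding column of X
    vanishes.  If there are two, a and b, each row of X is a scalar multiple of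
    (b, -a) in the first two columns, so row operations clear a 2 x 2 block.
    If there are three, every row is a scalar combination of the three Koszul
    syzygies (koszul3), so X is a scalar matrix times an antisymmetric one:
    either the scalar matrix can be inverted, or it can be given a zero row.
    A left kernel vector is treated by transposing.

    _Existence of the linear kernel vector_ (exists_linear_kernel).  Suppose
    that X takes at some point p a value of rank 2, normalised to
    E = diag(1, 1, 0), and write X as the block matrix [P, c; r, s].  The
    polynomial det (X + t E) is det X after translation by t p, so it vanishes,
    and its three coefficients say that s = 0, r c = 0 and r adj(P) c = 0
    (det_pencil); given the second, the third amounts to r P c = 0.  If c = 0 or r = 0, X has a zero column or row.
    Otherwise P c and c are both orthogonal to r, hence parallel, and since a
    linear form generates a prime ideal this forces P c = g c for some
    polynomial g (linear_eigenvector): the vector (-c, g) is killed by X.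
    If the generic rank is at most 1, the 2 x 2 minors of X vanish and provide
    a kernel vector directly.

    A small field may have no point p as above, so p is taken to be the generic
    point, over the fraction field of k[y_1, ..., y_n].  The kernel vector found
    there comes back to k[x] by clearing denominators and then extracting the
    coefficient of a suitable monomial in y, since X does not involve y
    (linear_kernel_descent).  The only arithmetic of polynomials involved is the
    primality of linear forms (linear_form_prime), which follows by eliminating
    one variable. *)

(** * Matrices of size three *)

Notation i0 := (@Ordinal 3 0 isT).
Notation i1 := (@Ordinal 3 1 isT).
Notation i2 := (@Ordinal 3 2 isT).

Lemma ord3P (P : 'I_3 -> Prop) : P i0 -> P i1 -> P i2 -> forall i, P i.
Proof.
move=> P0 P1 P2 [[|[|[|m]]] lt_m3] //.
- by rewrite (_ : Ordinal _ = i0) //; apply: val_inj.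
- by rewrite (_ : Ordinal _ = i1) //; apply: val_inj.
- by rewrite (_ : Ordinal _ = i2) //; apply: val_inj.
Qed.

Lemma sum3 (V : nmodType) (F : 'I_3 -> V) :
  \sum_i F i = F i0 + F i1 + F i2.
Proof.
rewrite !big_ord_recl big_ord0 addr0 addrA.
by congr (F _ + F _ + F _); apply: val_inj.
Qed.

Lemma det3 (A : comNzRingType) (M : 'M[A]_3) :
  \det M = M i0 i0 * (M i1 i1 * M i2 i2 - M i1 i2 * M i2 i1)
         - M i0 i1 * (M i1 i0 * M i2 i2 - M i1 i2 * M i2 i0)
         + M i0 i2 * (M i1 i0 * M i2 i1 - M i1 i1 * M i2 i0).
Proof.
rewrite (expand_det_row _ ord0) !big_ord_recl big_ord0 /cofactor.
rewrite !(expand_det_row _ ord0) !big_ord_recl !big_ord0 /cofactor !det_mx11.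
(* Indexing the entries by plain numbers lets all index computations reduce. *)
have [f Mf] : exists f : nat -> nat -> A, forall i j, M i j = f i j.
  by exists (fun i j => M (inord i) (inord j)) => i j; rewrite !inord_val.
rewrite !mxE /= !Mf /= /bump /=; ring.
Qed.

(** With M in block form [P, c; r, s], the coefficients of t^2, t and 1 in
    det (M + t diag(1, 1, 0)) are s, s tr P - r c and s det P - r adj(P) c. *)
Lemma det_pencil (A : comNzRingType) (M : 'M[A]_3) :
    \det (map_mx polyC M + 'X *: pid_mx 2) = 0 ->
  [/\ M i2 i2 = 0, M i2 i0 * M i0 i2 + M i2 i1 * M i1 i2 = 0 &
      M i2 i0 * (M i1 i1 * M i0 i2 - M i0 i1 * M i1 i2)
      + M i2 i1 * (M i0 i0 * M i1 i2 - M i1 i0 * M i0 i2) = 0].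
Proof.
rewrite det3 !mxE /= !mulr1 !mulr0 !addr0.
set D := (X in X = 0) => D0.
set s := M i2 i2.
set rc := (X in [/\ _, X = 0 & _]); set rPc := (X in [/\ _, _ & X = 0]).
have DE : D = s%:P * 'X^2 + (s * (M i0 i0 + M i1 i1) - rc)%:P * 'X
              + (s * (M i0 i0 * M i1 i1 - M i0 i1 * M i1 i0) - rPc)%:P.
  rewrite /D /s /rc /rPc; ring.
have Dcoef m : (s%:P * 'X^2 + (s * (M i0 i0 + M i1 i1) - rc)%:P * 'X
    + (s * (M i0 i0 * M i1 i1 - M i0 i1 * M i1 i0) - rPc)%:P)`_m = 0.
  by rewrite -DE D0 coef0.
have s0 : s = 0.
  by have := Dcoef 2%N; rewrite !coefE /= ?(mulr1, mulr0, mul0r, addr0, add0r).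
split=> //.
  have /eqP := Dcoef 1%N; rewrite !coefE /= s0.
  by rewrite ?(mulr1, mulr0, mul0r, addr0, add0r, sub0r) oppr_eq0 => /eqP.
have /eqP := Dcoef 0%N; rewrite !coefE /= s0.
by rewrite ?(mulr1, mulr0, mul0r, addr0, add0r, sub0r) oppr_eq0 => /eqP.
Qed.

(** * Linear forms and their syzygies *)

Section LinearForms.
Variables (K : fieldType) (n : nat).
Implicit Types (a b l p q : {mpoly K[n]}).

Lemma linear_formE l : l \is 1.-homog -> l = \sum_i l@_U_(i) *: 'X_i.
Proof.
move=> l_lin; apply/mpolyP=> m; rewrite raddf_sum /=.
have [/mdeg1P[j /eqP->]|m_nlin] := boolP (mdeg m == 1%N).
  rewrite (bigD1 j) //= mcoeffZ mcoeffXU eqxx mulr1 big1 ?addr0 // => i ne_ij.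
  by rewrite mcoeffZ mcoeffXU (negPf ne_ij) mulr0.
rewrite (dhomog_nemf_coeff l_lin m_nlin) big1 // => i _.
rewrite mcoeffZ mcoeffX (_ : (U_(i) == m)%MM = false) ?mulr0 //.
by apply: contraNF m_nlin => /eqP <-; rewrite mdeg1.
Qed.

Lemma linear_form_neq0 l : l \is 1.-homog -> l != 0 -> exists i, l@_U_(i) != 0.
Proof.
move=> l_lin l_neq0; have [i li_neq0|l0] := pickP (fun i => l@_U_(i) != 0).
  by exists i.
case/eqP: l_neq0; rewrite (linear_formE l_lin) big1 // => i _.
by move: (l0 i) => /= /negbFE/eqP ->; rewrite scale0r.
Qed.

(** Dividing out by a linear form: phi solves a = 0 for one of the variables,
    and is thus the projection onto a copy of the quotient ring by the ideal
    (a). On linear forms the quotient is a scalar, which tracks degrees. *)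
Lemma linear_form_elim a : a \is 1.-homog -> a != 0 ->
  exists phi : {rmorphism {mpoly K[n]} -> {mpoly K[n]}},
  [/\ phi a = 0, forall p, exists s, p = phi p + a * s
    & forall l, l \is 1.-homog -> exists c, l = phi l + c *: a].
Proof.
move=> a_lin a_neq0; have [i ai_neq0] := linear_form_neq0 a_lin a_neq0.
pose t := [tuple 'X_j - ((j == i)%:R / a@_U_(i)) *: a | j < n].
have phiX j : 'X_j \mPo t = 'X_j - ((j == i)%:R / a@_U_(i)) *: a.
  by rewrite comp_mpolyXU -tnth_nth tnth_mktuple.
have phiL l : l \is 1.-homog -> l \mPo t = l - (l@_U_(i) / a@_U_(i)) *: a.
  move=> l_lin; rewrite {1}(linear_formE l_lin) raddf_sum /=.
  under eq_bigr => j _ do rewrite comp_mpolyZ phiX scalerBr scalerA.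
  rewrite sumrB -linear_formE // -scaler_suml; congr (_ - _ *: _).
  rewrite (bigD1 i) //= eqxx big1 ?addr0 ?mul1r // => j /negPf->.
  by rewrite mul0r mulr0.
exists (comp_mpoly t); split=> [|p|l l_lin].
- by rewrite /= phiL // divff // scale1r subrr.
(* Being congruent to its image modulo a is stable under sums and products. *)
- elim/mpolyind: p => [|c m p _ _ [s IHp]].
    by exists 0; rewrite /= comp_mpoly0 mulr0 addr0.
  have [u Xm] : exists u, 'X_[m] = 'X_[m] \mPo t + a * u.
    rewrite mpolyXE_id.
    apply: (big_ind (fun q => exists u, q = (q \mPo t) + a * u)).
    + by exists 0; rewrite comp_mpoly1 mulr0 addr0.
    + move=> x y [u xE] [w yE]; exists (u * (y \mPo t) + x * w).
      rewrite rmorphM /= mulrDr addrA [a * (u * _)]mulrA -mulrDl -xE.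
      by rewrite {1}yE mulrDr mulrCA.
    + move=> j _; elim: (m j) => [|d [w IHd]].
        by exists 0; rewrite expr0 comp_mpoly1 mulr0 addr0.
      exists (((j == i)%:R / a@_U_(i))%:MP * ('X_j ^+ d \mPo t) + 'X_j * w).
      rewrite exprS rmorphM /= phiX {1}IHd -mul_mpolyC; ring.
  exists (c%:MP * u + s).
  rewrite raddfD /= comp_mpolyZ {1}IHp {1}Xm -!mul_mpolyC; ring.
- by exists (l@_U_(i) / a@_U_(i)); rewrite /= phiL // subrK.
Qed.

Lemma linear_form_colinear a b : a \is 1.-homog -> a != 0 ->
  (exists c, b = c *: a) \/ (forall c, b != c *: a).
Proof.
move=> a_lin a_neq0; have [i ai_neq0] := linear_form_neq0 a_lin a_neq0.
have [bE|b_neq] := eqVneq b ((b@_U_(i) / a@_U_(i)) *: a).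
  by left; exists (b@_U_(i) / a@_U_(i)).
right=> c; apply: contraNneq b_neq => ->.
by rewrite mcoeffZ mulfK.
Qed.

(** A linear form a generates a prime ideal: modulo a, the relation becomes
    b p = 0 in a domain where b is nonzero. *)
Lemma linear_form_prime a b q p : a \is 1.-homog -> b \is 1.-homog ->
    a != 0 -> (forall c, b != c *: a) -> a * q = b * p ->
  (exists s, p = a * s) /\ (p \is 1.-homog -> exists c, p = c *: a).
Proof.
move=> a_lin b_lin a_neq0 ab_free eq_aq_bp.
have [phi [phia phiP phiL]] := linear_form_elim a_lin a_neq0.
have phip : phi p = 0.
  have /eqP := congr1 phi eq_aq_bp; rewrite !rmorphM phia mul0r eq_sym mulf_eq0.
  case/orP=> [/eqP phib|/eqP //]; have [c bE] := phiL b b_lin.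
  by have /eqP[] := ab_free c; rewrite bE phib add0r.
split=> [|/phiL[c]]; first by have [s] := phiP p; rewrite phip add0r; exists s.
by rewrite phip add0r; exists c.
Qed.

(** Exactness of the Koszul complex of three independent linear forms, in degree
    1. Modulo a the relation becomes a syzygy between the images of b and c,
    which determines q and s up to multiples of a; then p is forced. *)
Lemma koszul3 a b c p q s :
    a \is 1.-homog -> b \is 1.-homog -> c \is 1.-homog ->
    p \is 1.-homog -> q \is 1.-homog -> s \is 1.-homog ->
    (forall x y z : K,
       x *: a + y *: b + z *: c = 0 -> [/\ x = 0, y = 0 & z = 0]) ->
    p * a + q * b + s * c = 0 ->
  exists x y z : K,
    [/\ p = z *: b - y *: c, q = x *: c - z *: a & s = y *: a - x *: b].
Proof.
move=> a_lin b_lin c_lin p_lin q_lin s_lin free_abc syz.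
have a_neq0 : a != 0.
  apply/eqP=> a0; have [|/eqP] := free_abc 1 0 0; last by rewrite oner_eq0.
  by rewrite a0 scaler0 !scale0r !addr0.
have [phi [phia _ phiL]] := linear_form_elim a_lin a_neq0.
have [[beta bE] [gamma cE] [y qE] [z sE]] :=
  And4 (phiL b b_lin) (phiL c c_lin) (phiL q q_lin) (phiL s s_lin).
have linB l u : l = phi l + u *: a -> l \is 1.-homog -> phi l \is 1.-homog.
  move=> lE l_lin; rewrite (_ : phi l = l - u *: a).
    by rewrite rpredB ?rpredZ.
  by apply/esym; rewrite {1}lE addrK.
have := congr1 phi syz; rewrite !rmorphD !rmorphM phia mulr0 add0r rmorph0 => syz'.
have phib_neq0 : phi b != 0.
  apply/eqP=> pb0; have [|_ /eqP] := free_abc (- beta) 1 0; last by rewrite oner_eq0.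
  by rewrite bE pb0 add0r !scale0r scale1r addr0 scaleNr addNr.
have pbc_free u : phi c != u *: phi b.
  apply/eqP=> pcE; have [|_ _ /eqP] := free_abc (u * beta - gamma) (- u) 1;
    last by rewrite oner_eq0.
  rewrite [in _ *: b]bE [in _ *: c]cE pcE -!mul_mpolyC.
  rewrite !(mpolyCB, mpolyCN, mpolyCM, mpolyC1); ring.
have syz'' : phi b * - phi q = phi c * phi s.
  by apply/eqP; rewrite -subr_eq0 -oppr_eq0 -syz'; apply/eqP; ring.
have [_ /(_ (linB _ _ sE s_lin)) [u psE]] := linear_form_prime
  (linB _ _ bE b_lin) (linB _ _ cE c_lin) phib_neq0 pbc_free syz''.
have pqE : phi q = - u *: phi c.
  apply: (mulIf phib_neq0); apply/eqP.
  rewrite -subr_eq0 -syz' psE -!mul_mpolyC mpolyCN.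
  by apply/eqP; ring.
have subE l w : l = phi l + w *: a -> phi l = l - w%:MP * a.
  by move=> lE; apply/esym; rewrite {1}lE -mul_mpolyC addrK.
have qE' : q = - u *: c - - (y + u * gamma) *: a.
  rewrite qE pqE (subE _ _ cE) -!mul_mpolyC !(mpolyCN, mpolyCD, mpolyCM); ring.
have sE' : s = (z - u * beta) *: a - - u *: b.
  rewrite sE psE (subE _ _ bE) -!mul_mpolyC !(mpolyCN, mpolyCB, mpolyCM); ring.
(* The remaining equation for p can be checked after multiplication by a. *)
exists (- u), (z - u * beta), (- (y + u * gamma)); split=> //.
apply: (mulIf a_neq0); apply/eqP; rewrite -subr_eq0 -syz qE' sE' -!mul_mpolyC.
by apply/eqP; ring.
Qed.

(** If P c is parallel to c, it is a polynomial multiple of c as soon as the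
    entries of c are linear: either they are coprime, or c is a linear form
    times a constant vector, and that linear form cancels out. *)
Lemma linear_eigenvector (c1 c2 p11 p12 p21 p22 : {mpoly K[n]}) :
    c1 \is 1.-homog -> c2 \is 1.-homog -> (c1 != 0) || (c2 != 0) ->
    c1 * (p21 * c1 + p22 * c2) = c2 * (p11 * c1 + p12 * c2) ->
  exists g, p11 * c1 + p12 * c2 = g * c1 /\ p21 * c1 + p22 * c2 = g * c2.
Proof.
move=> c1_lin c2_lin c_neq0 par.
have [c10|c1_neq0] := eqVneq c1 0.
  move: c_neq0 par; rewrite c10 eqxx /= mul0r !mulr0 !add0r => c2_neq0 /esym/eqP.
  rewrite !mulf_eq0 orbC -orbA orbb (negPf c2_neq0) orbF => /eqP->.
  by exists p22; rewrite mul0r mulr0.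
have [[u c2E]|c12_free] := linear_form_colinear c2 c1_lin c1_neq0; last first.
  have [[s sE] _] := linear_form_prime c1_lin c2_lin c1_neq0 c12_free par.
  exists s; split; first by rewrite sE mulrC.
  by apply: (mulfI c1_neq0); rewrite par sE; ring.
exists (p11 + p12 * u%:MP); rewrite c2E -mul_mpolyC; split; first by ring.
apply: (mulfI c1_neq0); rewrite c2E -mul_mpolyC in par.
by rewrite par; ring.
Qed.

End LinearForms.

(** * Homogeneous components *)

Section Homogeneous.
Variables (K : fieldType) (n : nat).

Lemma mcoeff_pihomog d (p : {mpoly K[n]}) m :
  mdeg m = d -> (pihomog mdeg d p)@_m = p@_m.
Proof.
move=> md; set e := maxn d.+1 (msize p).
have pE := @pihomog_partitionE _ _ mdeg e p (leq_maxr _ _).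
have lt_de : (d < e)%N by rewrite leq_maxl.
rewrite [in RHS]pE (bigD1 (Ordinal lt_de)) //= mcoeffD [X in _ + X](_ : _ = 0) ?addr0 //.
rewrite raddf_sum big1 //= => b b_neq.
have m_neqb : mdeg m != b.
  by rewrite md; apply: contraNneq b_neq => db; apply/eqP/val_inj.
exact: (dhomog_nemf_coeff (pihomogP mdeg b p) m_neqb).
Qed.

Lemma pihomog_mul_linear d (l p : {mpoly K[n]}) : l \is 1.-homog ->
  pihomog mdeg d.+1 (l * p) = l * pihomog mdeg d p.
Proof.
move=> l_lin; set e := maxn d.+1 (msize p).
have pE := @pihomog_partitionE _ _ mdeg e p (leq_maxr _ _).
have lt_de : (d < e)%N by rewrite leq_maxl.
rewrite {1}pE mulr_sumr raddf_sum /= (bigD1 (Ordinal lt_de)) //= big1 => [|b b_neq].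
  by rewrite addr0 pihomog_dE // (@dhomogM _ _ _ 1 _ d) // pihomogP.
by rewrite (@pihomog_ne0 _ _ _ (1 + b)%N) // dhomogM // pihomogP.
Qed.

End Homogeneous.

(** * Kernel vectors with a linear part *)

Section LinearKernel.
Variables (K : fieldType) (n : nat).
Implicit Types (X : 'M[{mpoly K[n]}]_3).
Local Notation C := (map_mx (@mpolyC n K)).

(** When X has linear entries, the component of degree 1 of a kernel vector is
    again a kernel vector, so that only the nonvanishing of this component needs
    to be recorded; homogeneity is restored at the very end. *)
Definition has_linear_kernel (X : 'M[{mpoly K[n]}]_3) :=
  exists (v : 'cV_3) (i : 'I_n), X *m v = 0 /\ map_mx (mcoeff U_(i)) v != 0.

Lemma has_linear_kernel_homog X : (forall r s, X r s \is 1.-homog) ->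
    has_linear_kernel X ->
  exists v : 'cV_3, [/\ forall j, v j 0 \is 1.-homog, v != 0 & X *m v = 0].
Proof.
move=> X_lin [v [i [Xv v_neq0]]]; exists (map_mx (pihomog mdeg 1) v); split=> [j||].
- by rewrite mxE pihomogP.
- apply: contra v_neq0 => /eqP v0; apply/eqP/matrixP=> j z.
  rewrite mxE -(@mcoeff_pihomog _ _ 1) ?mdeg1 //.
  by move/matrixP/(_ j z): v0; rewrite !mxE => ->; rewrite mcoeff0.
- apply/matrixP=> r z; rewrite mxE.
  under eq_bigr => s _ do rewrite mxE -pihomog_mul_linear //.
  rewrite -raddf_sum; move/matrixP/(_ r z): Xv; rewrite !mxE => ->.
  by rewrite raddf0.
Qed.

Lemma linear_mx_equiv (A B : 'M[K]_3) X :
    (forall r s, X r s \is 1.-homog) ->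
  forall r s, (C A *m X *m C B) r s \is 1.-homog.
Proof.
move=> X_lin r s; rewrite mxE rpred_sum // => a _.
rewrite [C B a s]mxE mulrC mul_mpolyC rpredZ //.
by rewrite mxE rpred_sum // => b _; rewrite mxE mul_mpolyC rpredZ.
Qed.

Lemma meval_mx_equiv (pt : 'I_n -> K) (A B : 'M[K]_3) X :
  map_mx (meval pt) (C A *m X *m C B)
    = A *m map_mx (meval pt) X *m B.
Proof.
have CK (D : 'M[K]_3) : map_mx (meval pt) (C D) = D.
  by apply/matrixP=> r s; rewrite !mxE mevalC.
by rewrite !map_mxM !CK.
Qed.

Lemma map_mulmx_mcoeff (G : 'M[K]_3) m (v : 'cV[{mpoly K[n]}]_3) :
  map_mx (mcoeff m) (C G *m v) = G *m map_mx (mcoeff m) v.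
Proof.
apply/matrixP=> i j; rewrite !mxE raddf_sum; apply: eq_bigr => l _.
by rewrite !mxE /= mcoeffCM.
Qed.

Lemma linear_kernel_equiv (F G : 'M[K]_3) X : F \in unitmx -> G \in unitmx ->
  has_linear_kernel (C F *m X *m C G) -> has_linear_kernel X.
Proof.
move=> F_unit G_unit [v [i [Xv v_neq0]]]; exists (C G *m v), i; split.
  have /(congr1 (mulmx (C (invmx F)))) := Xv.
  by rewrite -!mulmxA mulmx0 mulmxA -map_mxM mulVmx // map_mx1 mul1mx.
rewrite map_mulmx_mcoeff; apply: contra v_neq0 => /eqP Gv0.
by rewrite -[map_mx _ v](mulKmx G_unit) Gv0 mulmx0.
Qed.

Lemma linear_kernel_equiv_tr (F G : 'M[K]_3) X : F \in unitmx -> G \in unitmx ->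
  has_linear_kernel (C F *m X *m C G)^T -> has_linear_kernel X^T.
Proof.
move=> F_unit G_unit; rewrite !trmx_mul !map_trmx mulmxA.
by apply: linear_kernel_equiv; rewrite unitmx_tr.
Qed.

Lemma rank1_minors (Y : 'M[K]_3) r j u s : (\rank Y <= 1)%N ->
  Y r j * Y u s = Y r s * Y u j.
Proof.
rewrite -{-1}(mulmx_ebase Y).
have pidE a b : (\rank Y <= 1)%N ->
    (col_ebase Y *m pid_mx (\rank Y) *m row_ebase Y) a b =
    (0 < \rank Y)%:R * col_ebase Y a 0 * row_ebase Y 0 b.
  case: (\rank Y) => [|[|//]] _.
    by rewrite pid_mx_0 mulmx0 mul0mx mxE !mul0r.
  rewrite !mxE (bigD1 0) //= big1 ?addr0 => [|[[|a'] lta] //= _]; last first.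
    rewrite !mxE big1 ?mul0r // => b' _; rewrite mxE.
    by case: b' => -[|b'] ? /=; rewrite ?andbF mulr0.
  rewrite mxE (bigD1 0) //= big1 ?addr0 => [|b' b'0].
    by rewrite mxE mulr1 mul1r.
  by case: b' b'0 => -[|b'] ? // _; rewrite mxE mulr0.
by move=> rankY; rewrite !pidE //; ring.
Qed.

(** If (x_1, x_2, x_3) is a nonzero row of a matrix of rank at most 1, vectors
    such as (x_2, -x_1, 0) are killed by all its rows. *)
Lemma linear_kernel_rank1 (i : 'I_n) X : (forall r s, X r s \is 1.-homog) ->
    (forall r j u s, X r j * X u s = X r s * X u j) ->
  has_linear_kernel X.
Proof.
move=> X_lin minors0.
have [[r j] /= Xrj_neq0|X0] :=
  pickP (fun rs : 'I_3 * 'I_3 => X rs.1 rs.2 != 0); last first.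
  exists ('X_i *: delta_mx 0 0), i; split.
    apply/matrixP=> r s; rewrite !mxE big1 // => j _.
    by have /negbFE/eqP /= -> := X0 (r, j); rewrite mul0r.
  apply/eqP=> /matrixP/(_ 0 0); rewrite !mxE !eqxx mulr1 mcoeffXU eqxx.
  by move/eqP; rewrite oner_eq0.
have [t rt_neq0] := linear_form_neq0 (X_lin _ _) Xrj_neq0.
have [s sj] : exists s, s != j.
  exists (if j == i0 then i1 else i0).
  by move: j {Xrj_neq0 rt_neq0}; apply: ord3P.
exists (X r s *: delta_mx j 0 - X r j *: delta_mx s 0), t; split.
  rewrite mulmxBr -!scalemxAr -!colE; apply/matrixP=> u z; rewrite !mxE.
  by rewrite minors0 subrr.
apply/eqP=> /matrixP/(_ s 0)/eqP; rewrite !mxE !eqxx (negPf sj) mulr0 sub0r mulr1.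
by rewrite mcoeffN oppr_eq0 (negPf rt_neq0).
Qed.

(** The heart of the argument, at a point p where X takes the value
    diag(1, 1, 0). In block form X = [P, c; r, s], the kernel vector is (-c, g),
    where P c = g c. *)
Lemma linear_kernel_normal (i : 'I_n) (p : 'I_n -> K) (X : 'M[{mpoly K[n]}]_3) :
    (forall r s, X r s \is 1.-homog) -> map_mx (meval p) X = pid_mx 2 ->
  \det X = 0 -> has_linear_kernel X \/ has_linear_kernel X^T.
Proof.
move=> X_lin Xp detX0.
(* theta f is f (x + t p), as a polynomial in t. *)
pose theta : {rmorphism {mpoly K[n]} -> {poly {mpoly K[n]}}} :=
  mmap (polyC \o @mpolyC n K) (fun j => ('X_j)%:P + (p j)%:MP *: 'X).
have thetaL l : l \is 1.-homog -> theta l = l%:P + (l.@[p])%:MP *: 'X.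
  move=> l_lin; have lE := linear_formE l_lin.
  have -> : l.@[p] = \sum_j l@_U_(j) * p j.
    by rewrite {1}lE rmorph_sum; apply: eq_bigr => j _; rewrite /= mevalZ mevalXU.
  rewrite {1 2}lE !rmorph_sum scaler_suml -big_split /=.
  apply: eq_bigr => j _; rewrite mmapZ mmapX mmap1U /= -mul_mpolyC.
  by rewrite mulrDr -!mul_polyC !rmorphM mulrA.
have [s0 rc rPc] : [/\ X i2 i2 = 0, X i2 i0 * X i0 i2 + X i2 i1 * X i1 i2 = 0 &
      X i2 i0 * (X i1 i1 * X i0 i2 - X i0 i1 * X i1 i2)
      + X i2 i1 * (X i0 i0 * X i1 i2 - X i1 i0 * X i0 i2) = 0].
  apply: det_pencil.
  rewrite (_ : _ + _ = map_mx theta X) ?det_map_mx ?detX0 ?rmorph0 //.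
  apply/matrixP=> r s; rewrite !mxE thetaL //; congr (_ + _).
  move/matrixP/(_ r s): Xp; rewrite !mxE => ->.
  by case: (_ && _); rewrite ?mpolyC1 ?mpolyC0 ?scale1r ?scale0r ?mulr1 ?mulr0.
(* A zero column gives a constant kernel vector, and a linear one after
   multiplication by a variable. *)
have e3 (Y : 'M[{mpoly K[n]}]_3) : (forall r, Y r i2 = 0) -> has_linear_kernel Y.
  move=> Y0; exists ('X_i *: delta_mx i2 0), i; split.
    by apply/matrixP=> r s; rewrite !mxE sum3 !mxE /= Y0 !(mulr0, mul0r, addr0).
  apply/eqP=> /matrixP/(_ i2 0); rewrite !mxE !eqxx mulr1 mcoeffXU eqxx.
  by move/eqP; rewrite oner_eq0.
have [/andP[/eqP c10 /eqP c20]|c_neq0] :=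
  boolP ((X i0 i2 == 0) && (X i1 i2 == 0)).
  by left; apply: e3; apply: ord3P.
have [/andP[/eqP r10 /eqP r20]|r_neq0] :=
  boolP ((X i2 i0 == 0) && (X i2 i1 == 0)).
  by right; apply: e3; apply: ord3P; rewrite mxE.
left; rewrite !negb_and in c_neq0 r_neq0.
have [g [g1 g2]] : exists g, X i0 i0 * X i0 i2 + X i0 i1 * X i1 i2 = g * X i0 i2
    /\ X i1 i0 * X i0 i2 + X i1 i1 * X i1 i2 = g * X i1 i2.
  apply: linear_eigenvector => //; apply/eqP; rewrite -subr_eq0.
  set q1 := X i0 i0 * _ + _; set q2 := X i1 i0 * _ + _.
  (* By Cayley-Hamilton, adj P = tr P - P, so r P c = (tr P) r c - r adj(P) c. *)
  have rq : X i2 i0 * q1 + X i2 i1 * q2 = 0.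
    rewrite -[RHS](subrr 0) -{1}(mulr0 (X i0 i0 + X i1 i1)) -{1}rc -rPc /q1 /q2.
    by ring.
  case/orP: r_neq0 => r_neq0; apply/eqP/(mulfI r_neq0); rewrite mulr0.
    have -> : 0 = 0 * q2 - X i1 i2 * 0 by rewrite mul0r mulr0 subrr.
    by rewrite -{1}rc -{1}rq; ring.
  have -> : 0 = X i0 i2 * 0 - q1 * 0 by rewrite !mulr0 subrr.
  by rewrite -{1}rq -{1}rc; ring.
have [j cj_neq0] :
    exists j, ((X i0 i2)@_U_(j) != 0) || ((X i1 i2)@_U_(j) != 0).
  case/orP: c_neq0 => /(linear_form_neq0 (X_lin _ _))[j cj].
    by exists j; rewrite cj.
  by exists j; rewrite cj orbT.
exists (\col_r nth 0 [:: - X i0 i2; - X i1 i2; g] r), j; split.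
  apply/matrixP=> r s; rewrite !mxE sum3 !mxE /=.
  move: r; apply: ord3P; rewrite ?s0 ?[X i0 i2 * g]mulrC ?[X i1 i2 * g]mulrC;
    rewrite -?g1 -?g2; try by ring.
  by rewrite -[RHS]oppr0 -[in RHS]rc; ring.
apply: contraTneq cj_neq0 => /matrixP v0; rewrite negb_or !negbK.
have := v0 i1 0; have := v0 i0 0; rewrite !mxE /= !mcoeffN => /eqP + /eqP.
by rewrite !oppr_eq0 => -> ->.
Qed.

End LinearKernel.

(** * Descent from the generic point *)

Lemma map_mpoly_inj n (A B : nzRingType) (f : {additive A -> B}) :
  injective f -> injective (@map_mpoly n A B f).
Proof.
move=> f_inj p q /mpolyP pq; apply/mpolyP=> m; apply: f_inj.
by have := pq m; rewrite !mcoeff_map_mpoly.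
Qed.

Lemma map_mpoly_compose n (A B C : nzRingType) (f : {additive A -> B})
    (g : {additive B -> C}) (p : {mpoly A[n]}) :
  map_mpoly g (map_mpoly f p) = map_mpoly (g \o f) p.
Proof. by apply/mpolyP=> m; rewrite !mcoeff_map_mpoly. Qed.

Lemma meval_map_mpoly n (A B : nzRingType) (C : comNzRingType)
    (f : {rmorphism A -> B}) (g : {rmorphism B -> C})
    (pt : 'I_n -> B) (p : {mpoly A[n]}) :
  (map_mpoly (g \o f) p).@[g \o pt] = g (mmap f pt p).
Proof.
pose h : {rmorphism A -> C} := g \o f; rewrite -[g \o f]/(h : A -> C).
rewrite [p]mpolyE (rmorph_sum (map_mpoly h)) /= (raddf_sum (meval _)) /=.
rewrite (raddf_sum (mmap f pt)) raddf_sum /=; apply: eq_bigr => m _.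
rewrite (map_mpolyZ h) (map_mpolyX h) mevalZ mevalX mmapZ mmapX rmorphM.
by congr (_ * _); rewrite rmorph_prod; apply: eq_bigr => i _; rewrite rmorphXn.
Qed.

Section Denominators.
Variables (S : idomainType) (n : nat).
Local Notation F := (@FracField.tofrac S).

Lemma fraction_denominator (x : {fraction S}) :
  exists d m : S, d != 0 /\ F d * x = F m.
Proof.
elim/generic_quotient.quotW: x => -[[m d] /= d_neq0]; exists d, m; split=> //.
unlock FracField.tofrac; rewrite -[LHS]FracField.pi_mul.
apply/generic_quotient.eqmodP => /=.
rewrite FracField.equivfE /FracField.mulf /= !numden_Ratio ?mulf_neq0 ?oner_eq0 //.
by rewrite !(mul1r, mulr1) mulrC.
Qed.

Lemma mpoly_denominator (p : {mpoly {fraction S}[n]}) :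
  exists (d : S) (q : {mpoly S[n]}), d != 0 /\ map_mpoly F q = F d *: p.
Proof.
elim/mpolyind: p => [|c m p _ _ [d [q [d_neq0 qE]]]].
  by exists 1, 0; rewrite oner_eq0 raddf0 scaler0.
have [e [u [e_neq0 uE]]] := fraction_denominator c.
exists (e * d), (d * u *: 'X_[m] + e *: q); split; first by rewrite mulf_neq0.
rewrite rmorphD /= !map_mpolyZ map_mpolyX qE scalerDr !scalerA /= !tofracM -uE.
by congr (_ *: _ + _); rewrite mulrA [F d * _]mulrC.
Qed.

Lemma mpoly_cV_denominator m (v : 'cV[{mpoly {fraction S}[n]}]_m) :
  exists (d : S) (V : 'cV[{mpoly S[n]}]_m),
    d != 0 /\ map_mx (map_mpoly F) V = (F d)%:MP *: v.
Proof.
have /fin_all_exists2[d d_neq0 /fin_all_exists[q qE]] i :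
    exists2 d, d != 0 & exists q, map_mpoly F q = F d *: v i 0.
  by have [d [q []]] := mpoly_denominator (v i 0); exists d => //; exists q.
exists (\prod_i d i), (\col_i ((\prod_(j | j != i) d j) *: q i)); split.
  by apply/prodf_neq0 => i _.
apply/matrixP=> i j; rewrite !mxE map_mpolyZ qE scalerA -rmorphM mul_mpolyC !ord1.
by rewrite [in RHS](bigD1 i) //= mulrC.
Qed.

End Denominators.

(** The domain S plays the role of k[y_1, ..., y_n]; what matters is that the
    k-linear functionals on it separate its elements from 0. *)
Section Descent.
Variables (k : fieldType) (n : nat) (S : idomainType) (iota : {rmorphism k -> S}).
Implicit Types (X : 'M[{mpoly k[n]}]_3).
Local Notation F := (@FracField.tofrac S).

Lemma map_mpoly_functionalM (lam : {additive S -> k})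
    (a : {mpoly k[n]}) (V : {mpoly S[n]}) :
    (forall c s, lam (iota c * s) = c * lam s) ->
  map_mpoly lam (map_mpoly iota a * V) = a * map_mpoly lam V.
Proof.
move=> lamZ; apply/mpolyP => m'; rewrite mcoeff_map_mpoly !mcoeffM raddf_sum.
by apply: eq_bigr => b _; rewrite /= !mcoeff_map_mpoly lamZ.
Qed.

(** Once denominators are cleared, a k-linear functional lam from S to k maps a
    kernel vector over S[x] to one over k[x]; it is chosen nonzero on some
    coefficient of the linear part. For S = k[y], these functionals are
    coefficients of monomials in y. *)
Lemma linear_kernel_descent X :
    (forall s, s != 0 -> exists2 lam : {additive S -> k},
       lam s != 0 & forall c s, lam (iota c * s) = c * lam s) ->
  has_linear_kernel (map_mx (map_mpoly (F \o iota)) X) -> has_linear_kernel X.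
Proof.
move=> sep [v [i [Xv v_neq0]]].
have [d [V [d_neq0 VE]]] := mpoly_cV_denominator v.
have XV : map_mx (map_mpoly iota) X *m V = 0.
  have F_inj : injective (map_mpoly F : {mpoly S[n]} -> _).
    by apply: map_mpoly_inj => p q /eqP; rewrite tofrac_eq => /eqP.
  suff /matrixP XV : map_mx (map_mpoly F) (map_mx (map_mpoly iota) X *m V) = 0.
    apply/matrixP=> r z; apply: F_inj.
    by have := XV r z; rewrite !mxE => ->; rewrite raddf0.
  have XE : map_mx (map_mpoly F) (map_mx (map_mpoly iota) X)
            = map_mx (map_mpoly (F \o iota)) X.
    by apply/matrixP=> r s; rewrite !mxE map_mpoly_compose.
  by rewrite map_mxM VE XE -scalemxAr Xv scaler0.
have [j vj_neq0] : exists j, (v j 0)@_U_(i) != 0.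
  have [j vj|v0] := pickP (fun j => (v j 0)@_U_(i) != 0); first by exists j.
  case/eqP: v_neq0; apply/matrixP=> j z; rewrite !mxE ord1; apply/eqP.
  by have /negbFE := v0 j.
have Vj_neq0 : (V j 0)@_U_(i) != 0.
  rewrite -tofrac_eq0 -mcoeff_map_mpoly.
  move/matrixP/(_ j 0): VE; rewrite !mxE => ->.
  by rewrite mcoeffCM mulf_neq0 // tofrac_eq0.
have [lam lamV lamZ] := sep _ Vj_neq0.
exists (map_mx (map_mpoly lam) V), i; split.
  apply/matrixP=> r z; rewrite mxE.
  under eq_bigr => s _ do rewrite mxE -map_mpoly_functionalM //.
  rewrite -raddf_sum; move/matrixP/(_ r z): XV; rewrite !mxE.
  by under eq_bigr do rewrite mxE; move->; rewrite raddf0.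
apply/eqP=> /matrixP/(_ j 0)/eqP; rewrite !mxE mcoeff_map_mpoly.
by rewrite (negPf lamV).
Qed.

(** Injectivity of evaluation at pt says that pt is a generic point: the rank of
    X (pt) is the rank of X, and a rank at most 1 there means that all 2 x 2
    minors of X vanish. A rank of 2 allows normalising X (pt) by Gaussian
    elimination over the fraction field. *)
Lemma exists_linear_kernel_generic (pt : 'I_n -> S) X :
    injective (mmap iota pt : {mpoly k[n]} -> S) ->
    (forall s, s != 0 -> exists2 lam : {additive S -> k},
       lam s != 0 & forall c s, lam (iota c * s) = c * lam s) ->
    (0 < n)%N -> (forall r s, X r s \is 1.-homog) -> \det X = 0 ->
  has_linear_kernel X \/ has_linear_kernel X^T.
Proof.
move=> pt_gen sep n_gt0 X_lin detX0; pose i := Ordinal n_gt0.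
set Y := map_mx (F \o mmap iota pt) X.
have detY0 : \det Y = 0 by rewrite det_map_mx detX0 rmorph0.
have [Y1|Y2] := leqP (\rank Y) 1.
  left; apply: (linear_kernel_rank1 i X_lin) => r j u s; apply: pt_gen; apply/eqP.
  rewrite -tofrac_eq !rmorphM; have := rank1_minors r j u s Y1.
  by rewrite !mxE => ->.
have rankY : \rank Y = 2.
  apply/eqP; rewrite eqn_leq Y2 andbT -ltnS ltn_neqAle rank_leq_row andbT.
  apply/negP => Y_unit.
  by move: Y_unit; rewrite -[_ == _]/(row_free Y) row_free_unit unitmxE detY0 unitr0.
pose Z : 'M[{mpoly {fraction S}[n]}]_3 := map_mx (map_mpoly (F \o iota)) X.
have Z_lin r s : Z r s \is 1.-homog.
  rewrite mxE; apply/dhomogP => m; rewrite mcoeff_msupp mcoeff_map_mpoly /=.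
  apply: contraNeq => m_neq1; rewrite tofrac_eq0.
  by rewrite (dhomog_nemf_coeff (X_lin r s) m_neq1) rmorph0.
have detZ0 : \det Z = 0 by rewrite det_map_mx detX0 rmorph0.
pose L := invmx (col_ebase Y); pose G := invmx (row_ebase Y).
have L_unit : L \in unitmx by rewrite unitmx_inv col_ebase_unit.
have G_unit : G \in unitmx by rewrite unitmx_inv row_ebase_unit.
pose C := map_mx (@mpolyC n {fraction S}) : 'M_3 -> 'M_3.
pose W := C L *m Z *m C G.
have W_lin r s : W r s \is 1.-homog.
  exact: linear_mx_equiv.
have W_pt : map_mx (meval (F \o pt)) W = pid_mx 2.
  rewrite meval_mx_equiv (_ : map_mx _ Z = Y); last first.
    by apply/matrixP=> r s; rewrite !mxE meval_map_mpoly.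
  by rewrite -[in LHS](mulmx_ebase Y) rankY -!mulmxA mulmxV ?row_ebase_unit //
     mulmx1 mulKmx ?col_ebase_unit.
have detW0 : \det W = 0 by rewrite !det_mulmx detZ0 mulr0 mul0r.
case: (linear_kernel_normal i W_lin W_pt detW0) => [|kW].
  by move/(linear_kernel_equiv L_unit G_unit)/(linear_kernel_descent sep); left.
right; apply: (linear_kernel_descent sep); rewrite -map_trmx.
exact: (linear_kernel_equiv_tr L_unit G_unit kW).
Qed.

End Descent.

Lemma exists_linear_kernel (k : fieldType) n (X : 'M[{mpoly k[n]}]_3) :
    (0 < n)%N -> (forall r s, X r s \is 1.-homog) -> \det X = 0 ->
  has_linear_kernel X \/ has_linear_kernel X^T.
Proof.
(* The generic point is the tuple of variables. *)
apply: (@exists_linear_kernel_generic _ _ {mpoly k[n]} (@mpolyC n k)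
  (fun i => 'X_i)).
  have idE (p : {mpoly k[n]}) : mmap (@mpolyC n k) (fun i => 'X_i) p = p.
    rewrite [RHS]mpolyE; apply: eq_bigr => m _.
    by rewrite mmap1_id mul_mpolyC.
  by move=> p q; rewrite !idE.
move=> s s_neq0; exists (mcoeff (mlead s)) => [|c t]; first by rewrite mleadc_eq0.
exact: mcoeffCM.
Qed.

(** * Classification by the entries of the kernel vector *)

Section Classification.
Variables (k : fieldType) (n : nat).
Implicit Types (X Y : 'M[{mpoly k[n]}]_3).
Local Notation C := (map_mx (@mpolyC n k)).

(** Gaussian elimination on the coefficient matrix of v makes its first r
    entries linearly independent and the other ones zero. *)
Lemma linear_cV_normal (v : 'cV[{mpoly k[n]}]_3) :
    (forall j, v j 0 \is 1.-homog) ->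
  exists (L : 'M[k]_3) (r : nat), [/\ L \in unitmx, (r <= 3)%N,
    forall j : 'I_3, (r <= j)%N -> (C L *m v) j 0 = 0
  & forall a : 'rV[k]_3, C a *m (C L *m v) = 0 ->
      forall j : 'I_3, (j < r)%N -> a 0 j = 0].
Proof.
move=> v_lin; pose x : 'cV[{mpoly k[n]}]_n := \col_j 'X_j.
have x_free (b : 'rV[k]_n) : C b *m x = 0 -> b = 0.
  move=> /matrixP/(_ 0 0); rewrite !mxE => bx0; apply/rowP=> j; rewrite [RHS]mxE.
  rewrite -(mcoeff0 k U_(j)) -bx0 (raddf_sum (mcoeff U_(j))) (bigD1 j) //= !mxE.
  rewrite mcoeffCM mcoeffXU eqxx mulr1 big1 ?addr0 // => l ne_lj.
  by rewrite !mxE mcoeffCM mcoeffXU (negPf ne_lj) mulr0.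
pose W : 'M[k]_(3, n) := \matrix_(i, j) (v i 0)@_U_(j).
have vE : v = C W *m x.
  apply/matrixP=> i j; rewrite ord1 (linear_formE (v_lin i)) mxE.
  by apply: eq_bigr => l _; rewrite !mxE mul_mpolyC.
pose L := invmx (col_ebase W).
have LW : L *m W = pid_mx (\rank W) *m row_ebase W.
  by rewrite -{1}(mulmx_ebase W) /L -!mulmxA mulKmx ?col_ebase_unit.
have Lv : C L *m v = C (pid_mx (\rank W) *m row_ebase W) *m x.
  by rewrite vE mulmxA -map_mxM LW.
exists L, (\rank W); split; rewrite ?unitmx_inv ?col_ebase_unit ?rank_leq_row //.
  move=> j le_rj; rewrite Lv mxE big1 // => l _.
  rewrite !mxE big1 ?mpolyC0 ?mul0r // => t _.
  by rewrite mxE ltnNge le_rj andbF mul0r.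
move=> a; rewrite Lv mulmxA -map_mxM => /x_free aW j lt_jr.
have {aW}: a *m pid_mx (\rank W) = 0 :> 'rV_n.
  have := congr1 (mulmx^~ (invmx (row_ebase W))) aW.
  by rewrite mul0mx mulmxA mulmxK ?row_ebase_unit.
move/(congr1 (mulmx^~ (pid_mx (\rank W) : 'M_(n, 3)))).
rewrite mul0mx -mulmxA pid_mx_id ?rank_leq_col //.
move/matrixP/(_ 0 j); rewrite !mxE (bigD1 j) //= mxE eqxx lt_jr mulr1.
rewrite big1 ?addr0 // => l ne_lj.
by rewrite mxE -(inj_eq val_inj) in ne_lj *; rewrite (negPf ne_lj) mulr0.
Qed.

Lemma f_equivalent_mull X Y (F : 'M[k]_3) : F \in unitmx ->
  f_equivalent X Y -> f_equivalent X (C F *m Y).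
Proof.
move=> F_unit [A [B [A_unit B_unit ->]]]; exists (F *m A), B.
by rewrite unitmx_mul F_unit map_mxM !mulmxA.
Qed.

Lemma f_equivalent_mulr X (G : 'M[k]_3) : G \in unitmx -> f_equivalent X (X *m C G).
Proof.
by move=> G_unit; exists 1%:M, G; rewrite unitmx1 map_mx1 mul1mx.
Qed.

(** The number r of independent entries of v decides the shape: a zero column
    for r = 1, a zero square for r = 2, and for r = 3 an antisymmetric matrix or
    a zero row. *)
Lemma classify_right_kernel X (v : 'cV[{mpoly k[n]}]_3) :
    (forall i j, X i j \is 1.-homog) -> (forall j, v j 0 \is 1.-homog) ->
    v != 0 -> X *m v = 0 ->
  exists Y, f_equivalent X Y /\
    [\/ has_zero_row Y, has_zero_column Y, has_zero_square Y | is_antisymmetric Y].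
Proof.
move=> X_lin v_lin v_neq0 Xv.
have [L [r [L_unit le_r3 w_zero w_free]]] := linear_cV_normal v_lin.
set w := C L *m v in w_zero w_free; pose Z := X *m C (invmx L).
have XZ : f_equivalent X Z by apply: f_equivalent_mulr; rewrite unitmx_inv.
have w_lin j : w j 0 \is 1.-homog.
  by rewrite mxE rpred_sum // => l _; rewrite mxE mul_mpolyC rpredZ.
have Z_lin i j : Z i j \is 1.-homog.
  rewrite mxE rpred_sum // => l _.
  by rewrite [C _ _ _]mxE mulrC mul_mpolyC rpredZ.
have Zw i : Z i i0 * w i0 0 + Z i i1 * w i1 0 + Z i i2 * w i2 0 = 0.
  have : Z *m w = 0.
    rewrite /Z /w mulmxA -[X *m _ *m _]mulmxA -map_mxM mulVmx //.
    by rewrite map_mx1 mulmx1.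
  by move/matrixP/(_ i 0); rewrite mxE sum3 => ->; rewrite mxE.
have wE : w = C L *m v by [].
clearbody w Z.
have free a b c : a *: w i0 0 + b *: w i1 0 + c *: w i2 0 = 0 ->
    [/\ (0 < r)%N -> a = 0, (1 < r)%N -> b = 0 & (2 < r)%N -> c = 0].
  move=> abc; have H := w_free (\row_j nth 0 [:: a; b; c] j).
  have {}H : forall j : 'I_3, (j < r)%N ->
      (\row_(l < 3) nth 0 [:: a; b; c] l) 0 j = 0.
    apply: H; apply/matrixP=> ? ?; rewrite !ord1 mxE sum3 !mxE /=.
    by rewrite !mul_mpolyC abc.
  by have [[H0 H1] H2] := (H i0, H i1, H i2); split=> [/H0|/H1|/H2]; rewrite mxE.
case: r le_r3 w_zero free {w_free} => [|[|[|[|//]]]] _ w_zero free.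
- case/eqP: v_neq0; rewrite -[v]mul1mx -(map_mx1 (@mpolyC n k)) -(mulVmx L_unit).
  rewrite map_mxM -mulmxA -wE (_ : w = 0) ?mulmx0 //.
  by apply/matrixP=> i j; rewrite ord1 w_zero ?mxE.
- exists Z; split=> //; apply: Or42; exists i0 => i.
  have w0_neq0 : w i0 0 != 0.
    apply/eqP=> w0; have [|/(_ isT)/eqP] := free 1 0 0; last by rewrite oner_eq0.
    by rewrite w0 !(scaler0, scale0r, addr0).
  apply: (mulIf w0_neq0); rewrite mul0r -[RHS](Zw i).
  by rewrite (w_zero i1) // (w_zero i2) // !mulr0 !addr0.
- have w0_neq0 : w i0 0 != 0.
    apply/eqP=> w0; have [|/(_ isT)/eqP] := free 1 0 0; last by rewrite oner_eq0.
    by rewrite w0 !(scaler0, scale0r, addr0).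
  have w1_free c : w i1 0 != c *: w i0 0.
    apply/eqP=> w1; have [|_ /(_ isT)/eqP] := free (- c) 1 0; last by rewrite oner_eq0.
    by rewrite w1 scale1r scaleNr addNr scale0r addr0.
  have /fin_all_exists[lam lamE] i :
      exists c, Z i i0 = c *: w i1 0 /\ Z i i1 = - c *: w i0 0.
    have Z01 : w i0 0 * Z i i0 = w i1 0 * - Z i i1.
      apply/eqP; rewrite -subr_eq0 -[X in _ == X](Zw i) (w_zero i2) //.
      by apply/eqP; ring.
    have NZ_lin : - Z i i1 \is 1.-homog by rewrite rpredN.
    have [_ /(_ NZ_lin)[c cE]] :=
      linear_form_prime (w_lin i0) (w_lin i1) w0_neq0 w1_free Z01.
    have Z1 : Z i i1 = - c *: w i0 0 by rewrite scaleNr -cE opprK.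
    exists c; split=> //; apply: (mulIf w0_neq0); apply/eqP; rewrite -subr_eq0.
    rewrite -[X in _ == X](Zw i) (w_zero i2) // Z1 -!mul_mpolyC mpolyCN.
    by apply/eqP; ring.
  (* Row operations sending lam to a multiple of the first basis vector. *)
  pose lamv : 'cV[k]_3 := \col_i lam i; pose F := invmx (col_ebase lamv).
  have Flam (i : 'I_3) : i != i0 -> \sum_l F i l * lam l = 0.
    move=> i_neq0; have : (F *m lamv) i 0 = 0.
      rewrite -{1}(mulmx_ebase lamv) /F -!mulmxA mulKmx ?col_ebase_unit //.
      rewrite mxE big1 // => l _; rewrite mxE (_ : (i == l :> nat) = false) ?mul0r //.
      by rewrite (ord1 l); apply: negPf i_neq0.
    by rewrite mxE; under eq_bigr do rewrite mxE.
  have YE (i j : 'I_3) (u : {mpoly k[n]}) c :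
      (forall l, Z l j = (c * lam l) *: u) -> i != i0 -> (C F *m Z) i j = 0.
    move=> ZE /Flam Fi; rewrite mxE.
    under eq_bigr => l _ do rewrite mxE ZE mul_mpolyC scalerA mulrCA -scalerA.
    by rewrite -scaler_sumr -scaler_suml Fi scale0r scaler0.
  exists (C F *m Z); split.
    by apply: f_equivalent_mull; rewrite ?unitmx_inv ?col_ebase_unit.
  apply: Or43; exists i1, i2, i0, i1; split=> //.
  have Y0 i : i != i0 -> (C F *m Z) i i0 = 0.
    by apply: (YE _ _ (w i1 0) 1) => l; rewrite mul1r; case: (lamE l).
  have Y1 i : i != i0 -> (C F *m Z) i i1 = 0.
    by apply: (YE _ _ (w i0 0) (-1)) => l; rewrite mulN1r; case: (lamE l).
  by split; rewrite ?Y0 ?Y1.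
(* The rows of A are the Koszul syzygies of w. *)
pose A := antisym_mx (w i2 0) (w i1 0) (w i0 0).
have A_anti : is_antisymmetric A.
  by exists (w i2 0), (w i1 0), (w i0 0); split; rewrite ?/linear_form.
have /fin_all_exists[m mE] i : exists m : k * k * k,
   [/\ Z i i0 = m.2 *: w i1 0 - m.1.2 *: w i2 0,
       Z i i1 = m.1.1 *: w i2 0 - m.2 *: w i0 0
     & Z i i2 = m.1.2 *: w i0 0 - m.1.1 *: w i1 0].
  have w_free x y z : x *: w i0 0 + y *: w i1 0 + z *: w i2 0 = 0 ->
      [/\ x = 0, y = 0 & z = 0].
    by move=> /free[-> // -> // -> //].
  have [x [y [z H]]] := koszul3 (w_lin i0) (w_lin i1) (w_lin i2)
    (Z_lin i i0) (Z_lin i i1) (Z_lin i i2) w_free (Zw i).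
  by exists (x, y, z).
pose M : 'M[k]_3 := \matrix_(i, j) nth 0 [:: (m i).1.1; (m i).1.2; (m i).2] j.
have ZE : Z = C M *m A.
  apply/matrixP=> i j; rewrite mxE sum3 !mxE /=; have [z0 z1 z2] := mE i.
  by move: j; apply: ord3P; rewrite ?z0 ?z1 ?z2 /= -!mul_mpolyC; ring.
have [M_unit|M_sing] := boolP (M \in unitmx).
  exists (C (invmx M) *m Z); split.
    by apply: f_equivalent_mull; rewrite ?unitmx_inv.
  by apply: Or44; rewrite ZE mulmxA -map_mxM mulVmx // map_mx1 mul1mx.
(* Row operations clearing the last row of the singular matrix M. *)
exists (C (invmx (col_ebase M)) *m Z); split.
  by apply: f_equivalent_mull; rewrite ?unitmx_inv ?col_ebase_unit.
apply: Or41; exists i2 => j; rewrite ZE mulmxA -map_mxM -{2}(mulmx_ebase M).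
rewrite -!mulmxA mulKmx ?col_ebase_unit // mxE big1 // => l _.
rewrite !mxE big1 ?mpolyC0 ?mul0r // => t _; rewrite mxE.
have : (\rank M < 3)%N.
  rewrite ltn_neqAle rank_leq_row andbT.
  by rewrite -[_ == _]/(row_free M) row_free_unit.
by rewrite ltnS => /leq_gtF ->; rewrite andbF mul0r.
Qed.

Lemma is_antisymmetric_tr Y : is_antisymmetric Y -> is_antisymmetric Y^T.
Proof.
case=> phi [chi [psi [phi_lin chi_lin psi_lin ->]]].
exists (- phi), (- chi), (- psi); split; rewrite ?/linear_form ?rpredN //.
apply/matrixP=> i j; rewrite !mxE.
by move: i j; apply: ord3P; apply: ord3P; rewrite /= ?opprK.
Qed.

End Classification.

Theorem theorem7 (k : fieldType) (n : nat) (n_gt0 : (0 < n)%N)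
    (X : 'M[{mpoly k[n]}]_3)
    (X_linear : forall i j : 'I_3, linear_form (X i j))
    (detX0 : \det X = 0) :
  exists Y : 'M[{mpoly k[n]}]_3,
    f_equivalent X Y /\
    [\/ has_zero_row Y, has_zero_column Y, has_zero_square Y
      | is_antisymmetric Y].
Proof.
have XT_linear i j : X^T i j \is 1.-homog by rewrite mxE; apply: X_linear.
have [kX|kXT] := exists_linear_kernel n_gt0 X_linear detX0.
  have [v [v_lin v_neq0 Xv]] := has_linear_kernel_homog X_linear kX.
  exact: classify_right_kernel Xv.
have [v [v_lin v_neq0 Xv]] := has_linear_kernel_homog XT_linear kXT.
have [Y [[F [G [F_unit G_unit YE]]] Y_type]] :=
  classify_right_kernel XT_linear v_lin v_neq0 Xv.
exists Y^T; split.
  exists G^T, F^T; rewrite !unitmx_tr; split=> //.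
  by rewrite YE !trmx_mul trmxK !map_trmx mulmxA.
case: Y_type => [[i Y0]|[j Y0]|[r1 [r2 [c1 [c2 [r_neq c_neq [Y11 Y12 Y21 Y22]]]]]]|Y_anti].
- by apply: Or42; exists i => j; rewrite mxE.
- by apply: Or41; exists j => i; rewrite mxE.
- by apply: Or43; exists c1, c2, r1, r2; split=> //; split; rewrite mxE.
- by apply: Or44; apply: is_antisymmetric_tr.
Qed.
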